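(* Let $f\colon\mathbb{R}^n\to\mathbb{R}^n$ be a symmetric function and let $\Sigma_f\colon\mathrm{Sym}(n)\to\mathrm{Sym}(n)$ be the induced isotropic tensor function. Then: (i) $\Sigma_f$ is injective if and only if $f$ is injective. (ii) $\Sigma_f$ is surjective if and only if $f$ is surjective. In particular, $\Sigma_f$ is invertible if and only if $f$ is invertible.
   Context: $\mathrm{Sym}(n)$ denotes the real symmetric $n\times n$ matrices and $\mathrm{O}(n)$ the orthogonal group. A function $f=(f_1,\dots,f_n)\colon\mathbb{R}^n\to\mathbb{R}^n$ is called symmetric if $f_i(\lambda_{\pi(1)},\dots,\lambda_{\pi(n)})=f_{\pi(i)}(\lambda_1,\dots,\lambda_n)$ for all $\lambda\in\mathbb{R}^n$, all $i$ and all permutations $\pi$ of $\{1,\dots,n\}$. For such $f$ there is a unique well-defined function $\Sigma_f\colon\mathrm{Sym}(n)\to\mathrm{Sym}(n)$ with $$\Sigma_f\big(Q^T\mathrm{diag}(\lambda_1,\dots,\lambda_n)\,Q\big)=Q^T\mathrm{diag}(f(\lambda_1,\dots,\lambda_n))\,Q\qquad\text{for all } Q\in\mathrm{O}(n),\ \lambda\in\mathbb{R}^n.$$ Invertible means bijective. *)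

(* Defs.v *)
From HB Require Import structures.
From mathcomp Require Import all_boot all_order fingroup perm all_algebra.
From mathcomp Require Import sesquilinear spectral complex.
From mathcomp Require Import ring.
From mathcomp Require Import boolp classical_sets functions reals.

Set Implicit Arguments.
Unset Strict Implicit.
Unset Printing Implicit Defensive.

Import Order.TTheory GRing.Theory Num.Theory.
Local Open Scope ring_scope.

(* Vectors of R^n are row vectors, the argument type of [diag_mx]. *)

Definition SymMx (R : realType) (n : nat) := {A : 'M[R]_n | A \is symmetricmx}.

Definition orthogonal_mx (R : realType) (n : nat) (Q : 'M[R]_n) : Prop :=
  Q^T *m Q = 1%:M.

(* [col_perm p l] is the vector with i-th entry [l 0 (p i)]. *)
Definition symmetric_fun (R : realType) (n : nat)
    (f : 'rV[R]_n -> 'rV[R]_n) : Prop :=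
  forall (p : 'S_n) (l : 'rV[R]_n) (i : 'I_n),
    f (col_perm p l) 0 i = f l 0 (p i).

Lemma symmetricmxP (R : realType) n (A : 'M[R]_n) :
  reflect (A^T = A) (A \is symmetricmx).
Proof.
rewrite qualifE /= expr0 scale1r map_mx_id //.
by apply: (iffP eqP) => /esym.
Qed.

Lemma conj_diag_sym (R : realType) n (Q : 'M[R]_n) (l : 'rV[R]_n) :
  Q^T *m diag_mx l *m Q \is symmetricmx.
Proof. by apply/symmetricmxP; rewrite !trmx_mul trmxK tr_diag_mx mulmxA. Qed.

Definition conj_diag (R : realType) (n : nat) (Q : 'M[R]_n) (l : 'rV[R]_n) :
  SymMx R n := exist _ (Q^T *m diag_mx l *m Q) (conj_diag_sym Q l).

Definition induced_by (R : realType) (n : nat) (f : 'rV[R]_n -> 'rV[R]_n)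
    (Sigma : SymMx R n -> SymMx R n) : Prop :=
  forall (Q : 'M[R]_n) (l : 'rV[R]_n), orthogonal_mx Q ->
    Sigma (conj_diag Q l) = conj_diag Q (f l).

(* The rest of this file shows that a symmetric function induces exactly one
   function on symmetric matrices. *)

Lemma real_eigenvector (R : realType) n (A : 'M[R]_n) : (0 < n)%N ->
  A \is symmetricmx -> exists a (v : 'rV[R]_n), v != 0 /\ v *m A = a *: v.
Proof.
case: n A => // n A _ sA.
pose B : 'M[R[i]]_n.+1 := map_mx (real_complex R) A.
have Br : B \is a mxOver Num.real.
  by apply/mxOverP => i j; rewrite mxE; apply/complex_realP; exists (A i j).
have Bs : B \is symmetricmx.
  rewrite qualifE /= expr0 scale1r map_mx_id // /B map_trmx.
  by move/symmetricmxP: sA => ->.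
have Bh := realsym_hermsym Bs Br.
have /mxOverP/(_ 0 0)/complex_realP[x dx] := hermitian_spectral_diag_real Bh.
have /orthomx_spectralP BE := hermitian_normalmx Bh.
have Pu := spectral_unit B.
have : eigenvalue B x%:C%C.
  apply/eigenvalueP; exists (row 0 (spectralmx B)); last first.
    by apply: contraL Pu => /eqP r0; apply/negP => /mulmxV /(congr1 (row 0));
      rewrite row_mul r0 mul0mx row1 => /rowP/(_ 0)/eqP;
      rewrite !mxE eqxx eq_sym oner_eq0.
  rewrite -row_mul {2}BE !mulmxA mulmxV // mul1mx -dx.
  by apply/rowP => j; rewrite mul_diag_mx !mxE.
rewrite eigenvalue_root_char /B -map_char_poly fmorph_root.
rewrite -eigenvalue_root_char => /eigenvalueP[v vA v0].
by exists x, v.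
Qed.

Lemma orthogonalM (R : realType) n (P Q : 'M[R]_n) :
  orthogonal_mx P -> orthogonal_mx Q -> orthogonal_mx (P *m Q).
Proof.
by move=> oP oQ; rewrite /orthogonal_mx trmx_mul mulmxA -(mulmxA Q^T) oP mulmx1.
Qed.

Lemma householder (R : realType) n (v : 'rV[R]_n.+1) : v *m v^T = 1%:M ->
  exists H : 'M[R]_n.+1, orthogonal_mx H /\ row 0 H = v.
Proof.
move=> v1; pose e : 'rV[R]_n.+1 := delta_mx 0 0.
have [->|ve] := eqVneq v e.
  by exists 1%:M; rewrite /orthogonal_mx trmx1 mulmx1 row1.
pose w := v - e; pose c := (w *m w^T) 0 0.
have ee : e *m e^T = 1%:M.
  by rewrite trmx_delta mul_delta_mx; apply/matrixP => i j; rewrite !ord1 !mxE.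
have ev : e *m v^T = (v 0 0)%:M.
  by rewrite -rowE; apply/matrixP => i j; rewrite !ord1 !mxE.
have vec : v *m e^T = (v 0 0)%:M by rewrite -[LHS]trmxK trmx_mul trmxK ev tr_scalar_mx.
have cE : c = 2 - 2 * v 0 0.
  rewrite /c /w linearB /= mulmxBl !mulmxBr v1 ee ev vec !mxE /=.
  by rewrite !mulr1n; ring.
have c0 : c != 0.
  apply: contra_neq ve => c0; apply/eqP; rewrite -subr_eq0; apply/eqP/rowP => j.
  move/eqP: c0; rewrite /c mxE psumr_eq0; last first.
    by move=> i _; rewrite [w^T _ _]mxE -expr2 sqr_ge0.
  move=> /allP/(_ j (mem_index_enum _)); rewrite [w^T _ _]mxE -expr2 sqrf_eq0.
  by move=> /eqP wj; rewrite [RHS]mxE.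
pose K := w^T *m w; pose k := 2 / c.
have KT : K^T = K by rewrite /K trmx_mul trmxK.
have KK : K *m K = c *: K.
  have ww : w *m w^T = c%:M.
    by apply/matrixP => i j; rewrite !ord1 [RHS]mxE mulr1n.
  by rewrite /K -mulmxA (mulmxA w) ww mul_scalar_mx scalemxAr.
exists (1%:M - k *: K); split.
  have HT : (1%:M - k *: K)^T = 1%:M - k *: K.
    by rewrite linearB linearZ /= trmx1 KT.
  rewrite /orthogonal_mx HT mulmxBl mul1mx mulmxBr mulmx1.
  rewrite -scalemxAl -scalemxAr KK !scalerA.
  have -> : k * k * c = k *+ 2 by rewrite -mulrA [k * c]divfK // mulr_natr.
  by rewrite mulr2n scalerDl opprB addrK addrNK.
have eK : e *m K = (v 0 0 - 1) *: w.
  rewrite /K mulmxA.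
  have -> : e *m w^T = (v 0 0 - 1)%:M by rewrite linearB /= mulmxBr ev ee raddfB.
  by rewrite mul_scalar_mx.
rewrite rowE mulmxBr mulmx1 -scalemxAr eK scalerA /k.
have -> : 2 / c * (v 0 0 - 1) = - 1.
  by apply: (mulIf c0); rewrite mulrAC divfK // {1}cE; ring.
by rewrite scaleN1r opprK addrC subrK.
Qed.

Lemma real_spectral (R : realType) n (A : 'M[R]_n) : A \is symmetricmx ->
  exists (Q : 'M[R]_n) l, orthogonal_mx Q /\ A = Q^T *m diag_mx l *m Q.
Proof.
elim: n A => [|n IH] A sA.
  by exists 1%:M, 0; split; apply/matrixP => -[].
have [//|a [u [u0 uA]]] := real_eigenvector _ sA.
have s0 : 0 < (u *m u^T) 0 0.
  rewrite mxE lt_neqAle eq_sym sumr_ge0 ?andbT => [|i _]; last first.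
    by rewrite [u^T _ _]mxE -expr2 sqr_ge0.
  apply: contra u0; rewrite psumr_eq0 => [/allP u0|i _]; last first.
    by rewrite [u^T _ _]mxE -expr2 sqr_ge0.
  apply/eqP/rowP => j; have := u0 j (mem_index_enum _).
  by rewrite [u^T _ _]mxE -expr2 sqrf_eq0 [RHS]mxE => /eqP.
pose t := (Num.sqrt ((u *m u^T) 0 0))^-1.
pose v := t *: u.
have vA : v *m A = a *: v by rewrite -scalemxAl uA !scalerA mulrC.
have v1 : v *m v^T = 1%:M.
  apply/matrixP => i j; rewrite !ord1 linearZ /= -scalemxAl -scalemxAr scalerA.
  rewrite mxE [in RHS]mxE /t -expr2 exprVn sqr_sqrtr ?ltW // mulVf //.
  by rewrite gt_eqF.
have [H [oH Hv]] := householder v1.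
have oH' := mulmx1C oH.
have [B BH] : exists B : 'M[R]_(1 + n), B = H *m A *m H^T by eexists.
have sB : B^T = B.
  by rewrite BH !trmx_mul trmxK (symmetricmxP _ sA) mulmxA.
have rB : row 0 B = a *: delta_mx 0 0.
  rewrite BH !row_mul Hv vA -scalemxAl -Hv -row_mul oH' row1.
  by [].
have Bul : ulsubmx B = a%:M.
  apply/matrixP => i j; move/rowP/(_ 0): rB.
  rewrite !ord1 !mxE !eqxx mulr1 => <-.
  by congr (B _ _); apply: val_inj.
have Bur : ursubmx B = 0.
  apply/rowP => j; move/rowP/(_ (rshift 1 j)): rB.
  rewrite !mxE /= mulr0 => <-.
  by congr (B _ _); apply: val_inj.
have Bdl : dlsubmx B = 0 by rewrite -[LHS]trmxK trmx_dlsub sB Bur trmx0.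
have [|Q [l [oQ Ql]]] := IH (drsubmx B).
  by apply/symmetricmxP; rewrite trmx_drsub sB.
pose S : 'M[R]_(1 + n) := block_mx 1%:M 0 0 Q.
have oS : orthogonal_mx S.
  rewrite /orthogonal_mx /S tr_block_mx mulmx_block !trmx0 trmx1.
  rewrite !mulmx0 !mul0mx mulmx1 !addr0 !add0r oQ.
  by rewrite -scalar_mx_block.
exists (S *m H), (row_mx a%:M l); split; first exact: orthogonalM.
have BE : B = S^T *m diag_mx (row_mx a%:M l) *m S.
  rewrite -[LHS]submxK Bul Bur Bdl Ql /S tr_block_mx diag_mx_row.
  rewrite !mulmx_block !trmx0 trmx1.
  rewrite !mulmx0 !mul0mx !mulmx1 !mul1mx !addr0 !add0r !mul0mx.
  by congr block_mx; apply/matrixP => i j; rewrite !ord1 !mxE !eqxx.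
have -> : A = H^T *m B *m H by rewrite BH !mulmxA oH mul1mx -mulmxA oH mulmx1.
by rewrite BE trmx_mul !mulmxA.
Qed.

Lemma symmetric_fun_wd (R : realType) n (f : 'rV[R]_n -> 'rV[R]_n)
    (P Q : 'M[R]_n) (l m : 'rV[R]_n) : symmetric_fun f ->
  orthogonal_mx P -> orthogonal_mx Q ->
  P^T *m diag_mx l *m P = Q^T *m diag_mx m *m Q ->
  P^T *m diag_mx (f l) *m P = Q^T *m diag_mx (f m) *m Q.
Proof.
move=> sf oP oQ E.
have oP' := mulmx1C oP; have oQ' := mulmx1C oQ.
pose U := P *m Q^T.
have oU : orthogonal_mx U.
  by apply: orthogonalM => //; rewrite /orthogonal_mx trmxK.
have lm i j : U i j != 0 -> l 0 i = m 0 j.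
  move=> Uij; have : diag_mx l *m U = U *m diag_mx m.
    move/(congr1 (fun M => P *m M *m Q^T)): E.
    by rewrite /U !mulmxA oP' mul1mx -!mulmxA oQ' mulmx1 !mulmxA.
  move/matrixP/(_ i j); rewrite mul_diag_mx mul_mx_diag mxE [RHS]mxE mulrC.
  by move/(mulfI Uij).
have [s Us] : exists s : 'S_n, forall i, U i (s i) != 0.
  have : \det U != 0.
    apply/eqP => d0; move/(congr1 determinant): oU.
    by rewrite det_mulmx d0 mulr0 det1 => /esym/eqP; rewrite oner_eq0.
  have [/existsP[s /forallP Us] _|/existsPn nU] :=
    boolP [exists s : 'S_n, forall i, U i (s i) != 0]; first by exists s.
  case/eqP.
  rewrite /determinant big1 // => s _; case/forallPn: (nU s) => i.
  by rewrite negbK => /eqP Ui; rewrite (bigD1 i) //= Ui mul0r mulr0.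
have ls : l = col_perm s m by apply/rowP => i; rewrite mxE; apply: lm.
have lc i k : l 0 i = l 0 k -> f l 0 i = f l 0 k.
  move=> lik; have {1}<- : col_perm (tperm i k) l = l.
    by apply/rowP => j; rewrite mxE; case: tpermP => // ->.
  by rewrite sf tpermL.
have flm i j : U i j != 0 -> f l 0 i = f m 0 j.
  move=> Uij; rewrite (lc i (s^-1 j)%g); first by rewrite {1}ls sf permKV.
  by rewrite (lm _ _ Uij) {1}ls mxE permKV.
have flU : diag_mx (f l) *m U = U *m diag_mx (f m).
  apply/matrixP => i j; rewrite mul_diag_mx mul_mx_diag mxE [RHS]mxE mulrC.
  by have [->|/flm ->//] := eqVneq (U i j) 0; rewrite !mul0r.
have -> : P = U *m Q by rewrite /U -mulmxA oQ mulmx1.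
rewrite trmx_mul mulmxA -(mulmxA _ (diag_mx (f l)) U) flU mulmxA.
by rewrite -(mulmxA Q^T U^T U) oU mulmx1.
Qed.

Theorem induced_by_exists_unique (R : realType) (n : nat)
    (f : 'rV[R]_n -> 'rV[R]_n) : symmetric_fun f ->
  exists! Sigma : SymMx R n -> SymMx R n, induced_by f Sigma.
Proof.
move=> sf.
have spec (A : SymMx R n) : {Ql : 'M[R]_n * 'rV[R]_n |
    orthogonal_mx Ql.1 /\ A = conj_diag Ql.1 Ql.2}.
  apply: cid; have [Q [l [oQ E]]] := real_spectral (valP A).
  by exists (Q, l); split => //; apply: val_inj.
exists (fun A => conj_diag (sval (spec A)).1 (f (sval (spec A)).2)); split.
  move=> Q l oQ; case: (spec _) => -[P m] /= [oP /(congr1 val)/= E].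
  by apply: val_inj; apply: (symmetric_fun_wd sf oP oQ).
move=> S HS; apply/funext => A.
by case: (spec A) => -[P m] /= [oP ->]; rewrite HS.
Qed.

(* Main.v *)
Require Import Defs.
From mathcomp Require Import all_boot all_order fingroup perm all_algebra.
From mathcomp Require Import boolp classical_sets functions reals.

(** Every symmetric matrix is some [Q^T diag(l) Q], and by [symmetric_fun_wd]
    an equality [P^T diag(l) P = Q^T diag(m) Q] between two such
    decompositions survives the application of any symmetric [g] to both [l]
    and [m]. Restricting [Sigma] to diagonal matrices (the case [Q = 1]) gives
    back [f], so [f] is injective when [Sigma] is, and diagonalizing shows
    that [Sigma] is onto as soon as [f] is.
    The two remaining implications apply the invariance to a function [g]
    built from [f]. Such a [g] is symmetric because the range of [f] is stable
    under permutations of the coordinates ([symmetric_range]).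

    - If [f] is injective, take for [g] the inverse of [f] on its range,
      extended by 0 ([symmetric_left_inverse]). From
      [P^T diag(f l) P = Q^T diag(f m) Q] it follows that
      [P^T diag(l) P = Q^T diag(m) Q], so [Sigma] is injective.
    - If [Sigma] is onto, then [diag(y) = Q^T diag(f m) Q] for any given [y].
      Take for [g] the function with all coordinates 1 on the range of [f] and
      0 off it, where [0 < n]. The right-hand side becomes the identity
      matrix, hence [g y] is not 0 and [y] is a value of [f]
      ([range_spectral]). *)

Set Implicit Arguments.
Unset Strict Implicit.
Unset Printing Implicit Defensive.

Import GRing.Theory.
Local Open Scope ring_scope.

Lemma symmetric_funP (R : realType) n (f : 'rV[R]_n -> 'rV[R]_n) :
  symmetric_fun f <-> forall p l, f (col_perm p l) = col_perm p (f l).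
Proof.
split=> [sf p l|fp p l i]; last by rewrite fp mxE.
by apply/rowP => i; rewrite sf mxE.
Qed.

Lemma conj_diag_wd (R : realType) n (g : 'rV[R]_n -> 'rV[R]_n)
    (P Q : 'M[R]_n) (l m : 'rV[R]_n) : symmetric_fun g ->
  orthogonal_mx P -> orthogonal_mx Q ->
  conj_diag P l = conj_diag Q m -> conj_diag P (g l) = conj_diag Q (g m).
Proof.
move=> sg oP oQ /(congr1 val) E; apply: val_inj.
exact: symmetric_fun_wd sg oP oQ E.
Qed.

Lemma conj_diag_spectral (R : realType) n (A : SymMx R n) :
  exists Q l, orthogonal_mx Q /\ A = conj_diag Q l.
Proof.
have [Q [l [oQ E]]] := real_spectral (valP A).
by exists Q, l; split=> //; apply: val_inj.
Qed.

Lemma orthogonal1 (R : realType) n : orthogonal_mx (1%:M : 'M[R]_n).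
Proof. by rewrite /orthogonal_mx trmx1 mulmx1. Qed.

Lemma conj_diag_inj (R : realType) n (Q : 'M[R]_n) :
  orthogonal_mx Q -> injective (conj_diag Q).
Proof.
move=> oQ l m /(congr1 val) /= E; have oQ' := mulmx1C oQ.
move/(congr1 (fun M => Q *m M *m Q^T)): E.
rewrite !mulmxA oQ' !mul1mx -!mulmxA oQ' !mulmx1.
move=> /matrixP E; apply/rowP => i.
by have := E i i; rewrite !mxE eqxx !mulr1n.
Qed.

(** Permuting the coordinates of [f x] amounts to permuting those of [x]. The
    equivalence, rather than one implication, comes from the inverse
    permutation. *)
Lemma symmetric_range (R : realType) n (f : 'rV[R]_n -> 'rV[R]_n) p y :
  symmetric_fun f -> range f (col_perm p y) <-> range f y.
Proof.
move=> /symmetric_funP fp; split=> -[x _ fx]; last first.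
  by exists (col_perm p x) => //; rewrite fp fx.
exists (col_perm (p^-1)%g x) => //.
by rewrite fp fx -col_permM mulVg col_perm1.
Qed.

(** On the range of [f], the inverse of [f] is unique and so inherits the
    symmetry of [f]; extending it by the constant 0, a vector fixed by all
    permutations, keeps it symmetric. *)
Lemma symmetric_left_inverse (R : realType) n (f : 'rV[R]_n -> 'rV[R]_n) :
  symmetric_fun f -> injective f ->
  exists2 g : 'rV[R]_n -> 'rV[R]_n, symmetric_fun g & cancel f g.
Proof.
move=> sf injf; have /symmetric_funP fp := sf.
pose g y := if pselect (range f y) is left fy then s2val (cid2 fy) else 0.
have fK : cancel f g.
  rewrite /g => x; case: pselect => [fx|[]]; last by exists x.
  by case: cid2 => z _ /= /injf.
exists g => //; apply/symmetric_funP => p y.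
have [[x _ <-]|Nfy] := pselect (range f y); first by rewrite -fp !fK.
have g0 z : ~ range f z -> g z = 0 by rewrite /g; case: pselect.
rewrite !g0 //; last by move/(symmetric_range p y sf).
by apply/rowP => i; rewrite !mxE.
Qed.

(** Having its vector of eigenvalues in the range of [f] is a property of a
    matrix, whatever the diagonalization: the matrices [diag(g l)] below are
    the identity for [l] in the range and 0 otherwise, and these two matrices
    are fixed by every orthogonal conjugation. They differ only when [0 < n];
    for [n = 0] there is a single vector. *)
Lemma range_spectral (R : realType) n (f : 'rV[R]_n -> 'rV[R]_n)
    (P Q : 'M[R]_n) (l m : 'rV[R]_n) : symmetric_fun f ->
  orthogonal_mx P -> orthogonal_mx Q ->
  conj_diag P l = conj_diag Q m -> range f m -> range f l.
Proof.
case: n f P Q l m => [|n] f P Q l m sf oP oQ E fm.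
  by rewrite (thinmx0 l) -(thinmx0 m).
pose g y : 'rV[R]_n.+1 := const_mx (`[< range f y >]%:R).
have sg : symmetric_fun g.
  move=> p y i; rewrite !mxE; congr (nat_of_bool _)%:R.
  exact/asbool_equiv_eq/symmetric_range.
have /(congr1 val)/= := conj_diag_wd sg oP oQ E.
rewrite /g (asboolT fm) !diag_const_mx mulr1n mulmx1 oQ.
case: asboolP => // _; rewrite mulr0n raddf0 mulmx0 mul0mx.
by move/matrixP/(_ 0 0)/eqP; rewrite !mxE eqxx eq_sym oner_eq0.
Qed.

Lemma bijective_inj_surj (T : Type) (h : T -> T) :
  bijective h <-> injective h /\ set_surj [set: T] [set: T] h.
Proof.
rewrite -setTT_bijective; split=> [[_ hI hS]|[hI hS]].
  by split=> // x y; apply: hI; rewrite inE.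
by split=> // x y _ _; apply: hI.
Qed.

Theorem theorem4p1 (R : realType) (n : nat) (f : 'rV[R]_n -> 'rV[R]_n)
    (Sigma : SymMx R n -> SymMx R n)
    (f_sym : symmetric_fun f) (Sigma_f : induced_by f Sigma) :
  [/\ injective Sigma <-> injective f,
      set_surj [set: SymMx R n] [set: SymMx R n] Sigma <->
        set_surj [set: 'rV[R]_n] [set: 'rV[R]_n] f
    & bijective Sigma <-> bijective f].
Proof.
have o1 := orthogonal1 R n.
have inj_iff : injective Sigma <-> injective f.
  split=> [injS l m flm|injf A B].
    apply: (conj_diag_inj o1); apply: injS.
    by rewrite !Sigma_f // flm.
  have [g sg fK] := symmetric_left_inverse f_sym injf.
  have [P [l [oP ->]]] := conj_diag_spectral A.
  have [Q [m [oQ ->]]] := conj_diag_spectral B.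
  rewrite !Sigma_f // => /(conj_diag_wd sg oP oQ).
  by rewrite !fK.
have surj_iff : set_surj [set: SymMx R n] [set: SymMx R n] Sigma <->
    set_surj [set: 'rV[R]_n] [set: 'rV[R]_n] f.
  split=> [surjS y _|surjf A _].
    have [A _] := surjS (conj_diag 1%:M y) I.
    have [Q [m [oQ ->]]] := conj_diag_spectral A.
    rewrite Sigma_f // => /esym E.
    by apply: (range_spectral f_sym o1 oQ E); exists m.
  have [Q [l [oQ ->]]] := conj_diag_spectral A.
  have [m _ <-] := surjf l I.
  by exists (conj_diag Q m) => //; rewrite Sigma_f.
by split=> //; rewrite !bijective_inj_surj inj_iff surj_iff.
Qed.
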